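(* Let $A$ be an $n\times n$ integer matrix all of whose eigenvalues have modulus $>1$, let $m=|\det A|$, and let $D=\{d_1,\ldots,d_m\}\subset\mathbb{Z}^n$ be a coset transversal for $\mathbb{Z}^n/A(\mathbb{Z}^n)$. Let $X=\{x_1,\ldots,x_m\}$ and let $(\mathbb{Z}^n,X^* )$ be the contracting self-similar action defined by the virtual endomorphism $A^{-1}:A(\mathbb{Z}^n)\to\mathbb{Z}^n$, the coset transversal $D$ and the trivial cocycle. Let $\Phi:\mathcal{X}_{\mathbb{Z}^n}\to\mathbb{R}^n$ be the $\mathbb{Z}^n$-equivariant homeomorphism given by $$\Phi(\ldots x_{i_2}x_{i_1}\cdot g)=g+A^{-1}d_{i_1}+A^{-2}d_{i_2}+\ldots,\qquad i_j\in\{1,\ldots,m\},\ g\in\mathbb{Z}^n.$$ Then the push-forward $\Phi_*\mu$ of the measure $\mu$ on the limit $G$-space $\mathcal{X}_{\mathbb{Z}^n}$ is the Lebesgue measure $\lambda$ on $\mathbb{R}^n$.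
   Context: The self-similar action $(\mathbb{Z}^n,X^* )$ in the claim is the action of $\mathbb{Z}^n$ (written additively) on the set $X^*$ of finite words over $X$ determined recursively by $g(x_iw)=x_j\,(g|_{x_i})(w)$ for $g\in\mathbb{Z}^n$, $w\in X^*$, where $j$ is the unique index with $g+d_i-d_j\in A(\mathbb{Z}^n)$ and $g|_{x_i}=A^{-1}(g+d_i-d_j)$. For a word put $g|_{x_{i_1}\ldots x_{i_k}}=g|_{x_{i_1}}|_{x_{i_2}}\cdots|_{x_{i_k}}$. This action is faithful and contracting: there is a finite set $\mathcal{N}\subset\mathbb{Z}^n$ such that for every $g$ all restrictions $g|_v$ with $v$ long enough lie in $\mathcal{N}$. Let $G=\mathbb{Z}^n$ (discrete) and let $X^{-\omega}$ be the space of left-infinite sequences over $X$ with the product topology. Two elements $\ldots z_2z_1\cdot g$ and $\ldots y_2y_1\cdot h$ of $X^{-\omega}\times G$ are asymptotically equivalent if there are a finite set $K\subset G$ and $g_k\in K$, $k\ge1$, with $g_k(z_k\ldots z_1)=y_k\ldots y_1$ and $g_k|_{z_k\ldots z_1}+g=h$ for all $k\ge1$. The limit $G$-space $\mathcal{X}_{\mathbb{Z}^n}$ is the quotient topological space of $X^{-\omega}\times G$ by this relation, with $G$ acting by translation of the $G$-coordinate. The measure $\mu$ on $\mathcal{X}_{\mathbb{Z}^n}$ is the push-forward, under the quotient map, of the product of the uniform Bernoulli measure on $X^{-\omega}$ (each letter has weight $1/m$) and the counting measure on $G$. It is known that $\Phi$ is a well-defined $\mathbb{Z}^n$-equivariant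 homeomorphism. *)

(* Defs.v *)
From HB Require Import structures.
From mathcomp Require Import all_boot all_order all_algebra complex ring.
From mathcomp Require Import all_classical all_reals all_analysis.
Set Implicit Arguments.
Unset Strict Implicit.
Unset Printing Implicit Defensive.
Import Order.TTheory GRing.Theory Num.Theory.
Import numFieldNormedType.Exports.
Local Open Scope classical_set_scope.
Local Open Scope ring_scope.

Section SelfSimilarAction.
Variables (n p : nat) (A : 'M[int]_n) (d : 'I_p.+1 -> 'cV[int]_n).
Implicit Types (g h : 'cV[int]_n) (i j : 'I_p.+1) (w : seq 'I_p.+1).

(** The index set ['I_p.+1] (with [p.+1 = |det A|]) plays the role of the
    alphabet [X]; [d] enumerates the digit set [D]. *)
Definition coset_transversal :=
  forall g, exists! j, exists h, A *m h = g - d j.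

(** The virtual endomorphism [A^-1 : A(Z^n) -> Z^n], extended by [0]. *)
Definition virtual_endo g : 'cV[int]_n := xget 0 [set h | A *m h = g].

Definition act_letter g i : 'I_p.+1 :=
  xget i [set j | exists h, A *m h = g + d i - d j].

Definition restr_letter g i : 'cV[int]_n :=
  virtual_endo (g + d i - d (act_letter g i)).

Fixpoint act_word g w : seq 'I_p.+1 :=
  if w is i :: w' then act_letter g i :: act_word (restr_letter g i) w'
  else [::].

Fixpoint restr_word g w : 'cV[int]_n :=
  if w is i :: w' then restr_word (restr_letter g i) w' else g.

End SelfSimilarAction.

(** The left-infinite sequence [... x_2 x_1] is encoded by [k |-> x_(k+1)]. *)
Definition leftseq p := prod_topology (fun _ : nat => discrete_topology 'I_p.+1).
HB.instance Definition _ p := Topological.on (leftseq p).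
HB.instance Definition _ p := isPointed.Build (leftseq p) (fun=> ord0).

Definition lattice n := discrete_topology 'cV[int]_n.
HB.instance Definition _ n := Topological.on (lattice n).
HB.instance Definition _ n := isPointed.Build (lattice n) (0 : 'cV[int]_n).

(** [suffix_word x k] is the word [x_k ... x_1]. *)
Definition suffix_word p (x : leftseq p) k : seq 'I_p.+1 := rev (mkseq x k).

Section LimitSpace.
Variables (n p : nat) (A : 'M[int]_n) (d : 'I_p.+1 -> 'cV[int]_n).

Definition asymp (u v : leftseq p * lattice n) : Prop :=
  exists2 K : set 'cV[int]_n, finite_set K &
  exists gs : nat -> 'cV[int]_n, forall k, (0 < k)%N ->
    [/\ K (gs k),
        act_word A d (gs k) (suffix_word u.1 k) = suffix_word v.1 k &
        restr_word A d (gs k) (suffix_word u.1 k) + (u.2 : 'cV[int]_n) = v.2].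

Hypothesis detA : `|\det A|%N = p.+1.
Hypothesis trD : coset_transversal A d.

Lemma mulA_inj (h h' : 'cV[int]_n) : A *m h = A *m h' -> h = h'.
Proof.
have detA0 : \det A != 0 by rewrite -absz_eq0 detA.
move=> /(congr1 (mulmx (\adj A))); rewrite !mulmxA mul_adj_mx !mul_scalar_mx.
move=> e; apply/matrixP => i j; apply: (mulfI detA0).
by move/matrixP: e => /(_ i j); rewrite !mxE.
Qed.

Lemma restr_letterE g i :
  A *m restr_letter A d g i = g + d i - d (act_letter A d g i).
Proof.
have [j [[h hj] _]] := trD (g + d i).
have [h' e'] : [set j | exists h, A *m h = g + d i - d j] (act_letter A d g i).
  by apply: (@xgetPex _ i); exists j, h.
exact: (@xgetPex _ 0 [set h | A *m h = _] (ex_intro _ h' e')).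
Qed.

Lemma restr_letter_unique g i j h : A *m h = g + d i - d j ->
  j = act_letter A d g i /\ h = restr_letter A d g i.
Proof.
move=> e; have [j0 [_ u]] := trD (g + d i).
have ej : j = act_letter A d g i.
  rewrite -(u j); last by exists h.
  by apply: u; exists (restr_letter A d g i); exact: restr_letterE.
by split=> //; apply: mulA_inj; rewrite e restr_letterE -ej.
Qed.

Lemma act_letter0 i : act_letter A d 0 i = i /\ restr_letter A d 0 i = 0.
Proof.
have [|<- <-] // := @restr_letter_unique 0 i i 0.
by rewrite mulmx0 add0r subrr.
Qed.

Lemma act_letterD g h i :
  act_letter A d (g + h) i = act_letter A d g (act_letter A d h i) /\
  restr_letter A d (g + h) i =
    restr_letter A d g (act_letter A d h i) + restr_letter A d h i.
Proof.
have [|<- <-] // := @restr_letter_unique (g + h) i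
  (act_letter A d g (act_letter A d h i))
  (restr_letter A d g (act_letter A d h i) + restr_letter A d h i).
by rewrite mulmxDr !restr_letterE; apply/matrixP => a b; rewrite !mxE; ring.
Qed.

Lemma act_word0 w : act_word A d 0 w = w /\ restr_word A d 0 w = 0.
Proof. by elim: w => //= i w [IH IH']; have [-> ->] := act_letter0 i; rewrite IH. Qed.

Lemma act_wordD w g h :
  act_word A d (g + h) w = act_word A d g (act_word A d h w) /\
  restr_word A d (g + h) w =
    restr_word A d g (act_word A d h w) + restr_word A d h w.
Proof.
elim: w g h => //= i w IH g h; have [-> ->] := act_letterD g h i.
by have [-> ->] := IH (restr_letter A d g (act_letter A d h i))
  (restr_letter A d h i).
Qed.

Lemma asymp_refl u : asymp u u.
Proof.
exists [set 0] => //; exists (fun=> 0) => k _.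
by have [-> ->] := act_word0 (suffix_word u.1 k); rewrite add0r.
Qed.

Lemma asymp_sym u v : asymp u v -> asymp v u.
Proof.
move=> [K finK [gs gsP]]; exists (-%R @` K); first exact: finite_image.
exists (fun k => - gs k) => k k0; have [Kg eu ev] := gsP k k0.
have [] := act_wordD (suffix_word u.1 k) (- gs k) (gs k).
rewrite addNr (act_word0 _).1 (act_word0 _).2 eu => ea er.
split; [by exists (gs k) | by [] |]; by rewrite -ev addrA -er add0r.
Qed.

Lemma asymp_trans v u w : asymp u v -> asymp v w -> asymp u w.
Proof.
move=> [K finK [gs gsP]] [L finL [hs hsP]].
exists [set a + b | a in L & b in K]; first exact: finite_image2.
exists (fun k => hs k + gs k) => k k0.
have [Kg eu ev] := gsP k k0; have [Lh eu' ev'] := hsP k k0.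
have [-> ->] := act_wordD (suffix_word u.1 k) (hs k) (gs k).
split; [by exists (hs k) => //; exists (gs k) | by rewrite eu |].
by rewrite eu -addrA ev.
Qed.

Definition asympb u v := `[< asymp u v >].

Lemma asympb_refl : reflexive asympb.
Proof. by move=> u; apply/asboolP; exact: asymp_refl. Qed.

Lemma asympb_sym : symmetric asympb.
Proof. by move=> u v; apply/asboolP/asboolP; exact: asymp_sym. Qed.

Lemma asympb_trans : transitive asympb.
Proof.
by move=> v u w /asboolP uv /asboolP vw; apply/asboolP; exact: asymp_trans uv vw.
Qed.

Definition asymp_equiv : equiv_rel (leftseq p * lattice n) :=
  EquivRel asympb asympb_refl asympb_sym asympb_trans.

Definition limit_space := quotient_topology {eq_quot asymp_equiv}%qT.
HB.instance Definition _ := Topological.on limit_space.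
HB.instance Definition _ := Quotient.on limit_space.

Definition limit_pi (u : leftseq p * lattice n) : limit_space :=
  \pi_(limit_space)%qT u.

HB.instance Definition _ := isPointed.Build limit_space (limit_pi point).

End LimitSpace.
Arguments limit_pi {n p A d} detA trD u.

Definition borel (T : ptopologicalType) := g_sigma_algebraType (@open T).
HB.instance Definition _ (T : ptopologicalType) := Measurable.on (borel T).

Section Measures.
Variable R : realType.
Local Open Scope ereal_scope.

(** Each cylinder fixing [k] letters has mass [m ^- k] with [m = p.+1]; this
    determines a Borel measure on the sequence space. *)
Definition uniform_bernoulli p (nu : set (borel (leftseq p)) -> \bar R) :=
  forall w : seq 'I_p.+1,
    nu [set x : leftseq p | mkseq x (size w) = w] = (p.+1%:R ^- size w)%:E.

Definition limit_measure n p (A : 'M[int]_n) (d : 'I_p.+1 -> 'cV[int]_n)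
    (detA : `|\det A|%N = p.+1) (trD : coset_transversal A d)
    (nu : set (borel (leftseq p)) -> \bar R) :
    set (borel (limit_space detA trD)) -> \bar R :=
  pushforward (nu \x (@counting (borel (lattice n)) R))
    (limit_pi detA trD : borel (leftseq p) * borel (lattice n) ->
                         borel (limit_space detA trD)).

(** Lebesgue measure on [R^n] as the [n]-fold product of [lebesgue_measure],
    by integrating the measures of the sections over the first coordinate;
    it is meaningful on Borel sets. *)
Fixpoint lebesgue_cV n : set 'cV[R]_n -> \bar R :=
  match n with
  | 0 => fun B => \d_(0%R : borel 'cV[R]_0) B
  | n'.+1 => fun B => \int[lebesgue_measure]_(t in [set: R])
               lebesgue_cV [set v : 'cV[R]_n' | B (col_mx t%:M v)]
  end.

End Measures.
Arguments limit_measure {R n p A d} detA trD nu.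

Definition int_cV {R : realType} n (g : 'cV[int]_n) : 'cV[R]_n :=
  map_mx intr g.

Definition homeomorphism (S T : topologicalType) (f : S -> T) :=
  continuous f /\
  exists f' : T -> S, [/\ continuous f', cancel f f' & cancel f' f].

(* Main.v *)
(** Let [mu B] be the sum over [g] in [Z^n] of [nu {x | F x + g \in B}], where
    [F x = A^-1 d_(x_1) + A^-2 d_(x_2) + ...]; this is the push-forward of the
    measure on the limit space.  It is [Z^n]-periodic, and the relation
    [A F(j x) = d_j + F x] together with the bijection [(g, j) |-> A g + d_j]
    gives [mu (A^-1 B) = mu B / m].  Hence every element of the union of the
    groups [A^-N Z^n] is a period of [mu].  This union is dense because [Phi] is
    onto and its values are limits of elements of the union, so [mu] gives the
    same mass to all dyadic cubes of a given size; unit cubes have mass [1]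
    because [nu] is a probability.  Thus [mu] agrees with the Lebesgue measure
    on dyadic cubes, a pi-system generating the Borel sets. *)
Require Import Defs.
From HB Require Import structures.
From mathcomp Require Import all_boot all_order all_algebra complex ring lra zify.
From mathcomp Require Import all_classical all_reals all_analysis.
From mathcomp Require Import measurable_realfun.
Set Implicit Arguments.
Unset Strict Implicit.
Unset Printing Implicit Defensive.
Import Order.TTheory GRing.Theory Num.Theory.
Import numFieldNormedType.Exports.
Local Open Scope classical_set_scope.
Local Open Scope ring_scope.

(** * Sums and unions over countable types *)

Section Countable.
Context {R : realType} {I : countType}.
Local Open Scope ereal_scope.

(** Unordered sums become series over the natural numbers, to which monotone convergence and
    linearity apply; codes of no element contribute 0. *)
Lemma esum_pickle (a : I -> \bar R) : (forall i, 0 <= a i) ->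
  \esum_(i in [set: I]) a i = \sum_(k <oo) oapp a 0 (@pickle_inv I k).
Proof.
move=> a0; rewrite nneseries_esumT; last by move=> k; case: pickle_inv => /=.
rewrite (eq_esum (b := fun i => oapp a 0 (@pickle_inv I (pickle i)))); last first.
  by move=> i _; rewrite pickleK_inv.
rewrite -(esum_image [set: I] pickle (fun k => oapp a 0 (@pickle_inv I k)));
  last first.
  by move=> i j _ _; exact: (pcan_inj (@pickleK_inv I)).
rewrite esum_mkcond; apply: eq_esum => k _.
case: ifPn => // /negP; rewrite inE => nk.
case E : (@pickle_inv I k) => [i|] //=; case: nk; exists i => //.
by have := @pickle_invK I k; rewrite E.
Qed.

Lemma measure_countable_bigcup d (T : measurableType d)
    (mu : {measure set T -> \bar R}) (D : I -> set T) :
  (forall i, measurable (D i)) -> trivIset setT D ->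
  mu (\bigcup_i D i) = \esum_(i in [set: I]) mu (D i).
Proof.
move=> mD tD; pose E k := oapp D set0 (@pickle_inv I k).
have mE k : measurable (E k) by rewrite /E; case: pickle_inv => /=.
have -> : \bigcup_i D i = \bigcup_k E k.
  apply/seteqP; split=> x [i _ Dx].
    by exists (pickle i); rewrite // /E pickleK_inv.
  by move: Dx; rewrite /E; case: pickle_inv => //= j Dj; exists j.
have tE : trivIset setT E.
  move=> k l _ _ [x []]; rewrite /E.
  have := @pickle_invK I k; have := @pickle_invK I l.
  case: pickle_inv => [j|] //= jl; case: pickle_inv => [i|] //= ik Di Dj.
  by rewrite -jl -ik; congr pickle; apply: tD => //; exists x.
rewrite measure_semi_bigcup //; last exact: bigcupT_measurable.
rewrite esum_pickle //; apply: eq_eseriesr => k _.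
by rewrite /E; case: pickle_inv => //=; rewrite measure0.
Qed.

End Countable.

Definition image_measure d1 d2 (T1 : measurableType d1) (T2 : measurableType d2)
    (R : realType) (mu : {measure set T1 -> \bar R}) (f : T1 -> T2)
    (mf : measurable_fun setT f) : {measure set T2 -> \bar R}.
Proof. by refine (pushforward mu f : {measure set T2 -> \bar R}). Defined.

(** * Borel sigma-algebras and their generators *)

Section Borel.

Lemma borel_openE (T : ptopologicalType) :
  @measurable _ (borel T) = <<s @open T >>.
Proof. by []. Qed.

(** An open set is the union of the countably many [D i] contained in it, hence lies in
    [<<s G >>]. *)
Lemma borel_countable_base (T : ptopologicalType) (I : countType) (G : set (set T))
    (D : I -> set T) :
  (forall A, G A -> <<s @open T >> A) -> (forall i, G (D i)) ->
  (forall (U : set T) x, open U -> U x -> exists2 i, D i x & D i `<=` U) ->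
  @measurable _ (borel T) = <<s G >>.
Proof.
move=> Gm DG base; rewrite borel_openE; apply/seteqP; split; last first.
  by apply: smallest_sub => //; exact: smallest_sigma_algebra.
apply: smallest_sub; first exact: smallest_sigma_algebra.
move=> U oU; have -> : U = \bigcup_(i in [set i | D i `<=` U]) D i.
  apply/seteqP; split=> [x Ux|x [i /= DU /DU//]].
  by have [i Dx DU] := base _ _ oU Ux; exists i.
rewrite bigcup_mkcond.
apply: (@countable_bigcupT_measurable _ (g_sigma_algebraType G)) => //.
move=> i; case: ifP => _; last exact: measurable0.
exact: sub_sigma_algebra.
Qed.

Lemma continuous_borel (S T : ptopologicalType) (f : S -> T) :
  continuous f -> measurable_fun setT (f : borel S -> borel T).
Proof.
move=> /continuousP cf; apply: (measurability _ (borel_openE T)).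
move=> _ [U oU <-]; rewrite setTI; apply: sub_sigma_algebra; exact: cf.
Qed.

Lemma continuous_borel_real (R : realType) (S : ptopologicalType) (f : S -> R) :
  continuous f -> measurable_fun setT (f : borel S -> R).
Proof.
move=> /continuousP cf; apply: (measurability _ (RGenOInfty.measurableE R)) => //.
move=> _ [_ [x ->] <-]; rewrite setTI; apply: sub_sigma_algebra.
exact/cf/interval_open.
Qed.

End Borel.

(** * Dyadic cubes *)

Section Cubes.
Context {R : realType}.

Definition dyadic n k (v : 'cV[R]_n) : 'cV[int]_n :=
  \col_i Num.floor (2 ^+ k * v i 0).

(** As fibres of [dyadic k], the half-open cubes of side [2 ^- k] partition the space by
    construction. *)
Definition cube n k (z : 'cV[int]_n) : set 'cV[R]_n := [set v | dyadic k v = z].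

Lemma cubeP n k (z : 'cV[int]_n) (v : 'cV[R]_n) :
  cube k z v <-> forall i, (z i 0)%:~R <= 2 ^+ k * v i 0 < (z i 0 + 1)%:~R.
Proof.
split=> [<- i|zv]; first by rewrite mxE floor_itv.
by apply/colP => i; rewrite mxE; exact/floor_def.
Qed.

Lemma preimage_cube T n (f : T -> 'cV[R]_n) k z :
  f @^-1` cube k z = \bigcap_(i in [set: 'I_n])
    ((fun x => 2 ^+ k * f x i 0) @^-1` `[(z i 0)%:~R, (z i 0 + 1)%:~R[).
Proof.
by apply/seteqP; split=> [v /cubeP zv i _|v zv]; [|apply/cubeP => i];
  [have := zv i|have := zv i Logic.I]; rewrite /= in_itv.
Qed.

(** Taking the floor before dividing by [2 ^ j] does not change the floor of the quotient, so each
    fine cube lies in exactly one coarse cube. *)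
Lemma dyadic_coarsen n k j (v : 'cV[R]_n) :
  dyadic k v = map_mx (fun z => (z %/ (2 ^ j)%N)%Z) (dyadic (k + j) v).
Proof.
apply/colP => i; rewrite !mxE; apply: floor_def.
set x := v i 0; set z := Num.floor _.
have /andP[zl zu] := floor_itv (2 ^+ (k + j) * x); rewrite -/z in zl zu.
have j0 : ((2 ^ j)%N : int) != 0 by rewrite -lt0n expn_gt0.
have j0' : (0 : R) < 2 ^+ j by rewrite exprn_gt0.
have jE : ((2 ^ j)%N : int)%:~R = 2 ^+ j :> R by rewrite -pmulrn natrX.
have xE : 2 ^+ (k + j) * x = (2 ^+ k * x) * 2 ^+ j by rewrite exprD; ring.
apply/andP; split.
  rewrite -(ler_pM2r j0') -xE (le_trans _ zl)// -jE -intrM ler_int.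
  exact: lez_floor.
(* By integrality, [z] below a multiple of [2 ^ j] gives [z + 1] at most that multiple. *)
rewrite -(ltr_pM2r j0') -xE (lt_le_trans zu)// -jE -intrM ler_int -ltzD1.
by rewrite ltrD2r ltz_ceil// ltz_nat expn_gt0.
Qed.

Lemma measurable_coord n (i : 'I_n) :
  measurable_fun setT ((fun v => v i 0) : borel 'cV[R]_n -> R).
Proof.
exact: (continuous_borel_real (f := fun v : 'cV[R]_n => v i 0)
  (@coord_continuous _ _ _ i 0)).
Qed.

Lemma measurable_cube n k (z : 'cV[int]_n) :
  @measurable _ (borel 'cV[R]_n) (cube k z).
Proof.
have -> : cube k z = _ := preimage_cube (@id 'cV[R]_n) k z.
apply: (@fin_bigcap_measurable _ (borel 'cV[R]_n)) => // i _.
have mf : measurable_fun setT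
    ((fun v => 2 ^+ k * v i 0) : borel 'cV[R]_n -> R).
  by apply: measurable_funM => //; exact: measurable_coord.
by rewrite -[X in measurable X]setTI; exact: mf.
Qed.

Definition cubes n : set (set 'cV[R]_n) :=
  [set A | A = set0 \/ exists k z, A = cube k z].
Arguments cubes : clear implicits.

(** Dyadic cubes are nested or disjoint: the finer one lies in the coarser one exactly when its
    index coarsens to [z]. *)
Lemma cubesI n : setI_closed (cubes n).
Proof.
move=> A B; case=> [->|[k [z ->]]]; first by rewrite set0I; left.
case=> [->|[l [w ->]]]; first by rewrite setI0; left.
wlog kl : k l z w / (k <= l)%N.
  by move=> H; case/orP: (leq_total k l) => kl; [exact: H|rewrite setIC; exact: H].
rewrite -(subnKC kl); set c := map_mx (fun z => (z %/ (2 ^ (l - k))%N)%Z) w.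
have [zw|/eqP zw] := eqVneq z c.
  right; exists (k + (l - k))%N, w; apply/setIidPr => v /= vw.
  by rewrite zw /c -vw -dyadic_coarsen.
left; rewrite -subset0 => v [/= vz vw].
by apply: zw; rewrite /c -vz -vw -dyadic_coarsen.
Qed.

Lemma cube_base n (U : set 'cV[R]_n) x : open U -> U x ->
  exists k, cube k (dyadic k x) `<=` U.
Proof.
move=> oU Ux; have /nbhs_ballP[e /= e0 eU] := open_nbhs_nbhs (conj oU Ux).
have [k ke] : exists k, 2 ^- k < e.
  (* [e^-1 < 2 ^+ k] as soon as [k] reaches the Archimedean bound of [e^-1]. *)
  exists (Num.bound e^-1); rewrite -[ltRHS]invrK.
  rewrite ltf_pV2 ?posrE ?exprn_gt0 ?invr_gt0//.
  exact: upper_nthrootP.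
exists k => v /cubeP vx; apply: eU; split => // i j; rewrite (ord1 j).
have /andP[l1 u1] := vx i; rewrite mxE in l1 u1.
have /andP[l2 u2] := floor_itv (2 ^+ k * x i 0).
have k0 : (0 : R) < 2 ^+ k by rewrite exprn_gt0.
rewrite /ball /= (le_lt_trans _ ke)// -(ler_pM2l k0) divff ?gt_eqF//.
rewrite -{1}(gtr0_norm k0) -normrM mulrBr ler_norml.
by move: l1 u1 l2 u2; rewrite intrD; lra.
Qed.

Lemma borel_cubesE n : @measurable _ (borel 'cV[R]_n) = <<s cubes n >>.
Proof.
apply: (@borel_countable_base _ (nat * 'cV[int]_n)%type _
  (fun kz => cube kz.1 kz.2)).
- move=> A [->|[k [z ->]]]; last exact: measurable_cube.
  exact: (@measurable0 _ (borel 'cV[R]_n)).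
- by move=> [k z]; right; exists k, z.
- by move=> U x oU Ux; have [k kU] := cube_base oU Ux; exists (k, dyadic k x).
Qed.

(** Cubes generate the Borel sets, and the preimage of a cube is a finite intersection of preimages
    of intervals under the coordinates. *)
Lemma measurable_fun_cV d (T : measurableType d) n (f : T -> 'cV[R]_n) :
  (forall i, measurable_fun setT (fun x => f x i 0)) ->
  measurable_fun setT (f : T -> borel 'cV[R]_n).
Proof.
move=> mf; apply: (measurability _ (borel_cubesE n)).
move=> _ [_ [->|[k [z ->]]] <-]; first by rewrite preimage_set0 setI0.
rewrite setTI preimage_cube.
apply: fin_bigcap_measurable => // i _.
have mfi : measurable_fun setT (fun x => 2 ^+ k * f x i 0).
  exact: measurable_funM.
by rewrite -[X in measurable X]setTI; exact: mfi.
Qed.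

Lemma measure_cubes_unique n (m1 m2 : {measure set (borel 'cV[R]_n) -> \bar R}) :
  (forall z, (m1 (cube 0 z) < +oo)%E) ->
  (forall k z, m1 (cube k z) = m2 (cube k z)) ->
  forall B, measurable B -> m1 B = m2 B.
Proof.
move=> m1oo m12; pose g k := oapp (cube 0) set0 (@pickle_inv 'cV[int]_n k).
refine (@measure_unique _ R (borel 'cV[R]_n) (cubes n) g _ _ _ _ m1 m2 _ _).
- exact: borel_cubesE.
- exact: cubesI.
- by rewrite /g => k; case: pickle_inv => [z|]; [right; exists 0%N, z|left].
- apply/seteqP; split=> // v _; exists (pickle (dyadic 0 v)) => //.
  by rewrite /g pickleK_inv.
- by move=> _ [->|[k [z ->]]] //; rewrite !measure0.
- by rewrite /g => k; case: pickle_inv => //=; rewrite measure0.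
Qed.

End Cubes.
Arguments cubes {R} n.

(** * Mass of dyadic cubes under a normalised measure *)

Section CubeMeasure.
Context {R : realType}.

Lemma esum_fintype (I : finType) (a : I -> \bar R) : (forall i, 0 <= a i)%E ->
  (\esum_(i in [set: I]) a i = \sum_(i : I) a i)%E.
Proof.
move=> a0; rewrite esum_fset//; last exact: finite_finset.
rewrite (fsbigE (index_enum I)) ?index_enum_uniq//.
- by rewrite big_mkcond; apply: eq_bigr => i _; rewrite in_setT.
- by move=> i _; rewrite mem_index_enum.
Qed.

(** Indexing the subcubes by finite functions lets [card_ffun] count them in [measure_cube]. *)
Lemma unit_cube_split n k : cube 0 (0 : 'cV[int]_n) =
  \bigcup_(f : {ffun 'I_n -> 'I_(2 ^ k)})
    @cube R n k (\col_i (f i : nat)%:Z).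
Proof.
apply/seteqP; split=> [v|v [f _]] /=; rewrite /cube /= (@dyadic_coarsen _ _ 0 k).
  move=> /colP v0.
  have vb i : (`|dyadic k v i ord0| < 2 ^ k)%N /\ 0 <= dyadic k v i 0.
    have := v0 i; rewrite !mxE add0n => /eqP; set z := Num.floor _.
    have z2 : 0 < ((2 ^ k)%N : int) by rewrite ltz_nat expn_gt0.
    move=> /eqP zE.
    have := lez_floor z (lt0r_neq0 z2); have := ltz_ceil z z2.
    by rewrite zE; lia.
  exists [ffun i => Ordinal (vb i).1] => //=; apply/colP => i.
  by rewrite [RHS]mxE ffunE /= gez0_abs// (vb i).2.
rewrite add0n => ->; apply/colP => i; rewrite !mxE.
by rewrite divz_nat divn_small.
Qed.

(** [(2 ^ k) ^ n] disjoint cubes of equal mass fill a cube of mass 1. *)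
Lemma measure_cube n (m : {measure set (borel 'cV[R]_n) -> \bar R}) :
  m (cube 0 0) = 1%E -> (forall k z, m (cube k z) = m (cube k 0)) ->
  forall k z, m (cube k z) = ((2 ^- k) ^+ n)%:E.
Proof.
move=> m1 mz k z; rewrite mz.
have mE : (m (cube k 0) *+ #|{ffun 'I_n -> 'I_(2 ^ k)}| = 1)%E.
  rewrite -m1 (unit_cube_split n k) measure_countable_bigcup.
  - rewrite esum_fintype//; under eq_bigr do rewrite mz.
    by rewrite sumr_const.
  - by move=> f; exact: measurable_cube.
  - move=> f g _ _ [v [/= vf vg]]; apply/ffunP => i; apply/val_inj.
    by have /colP/(_ i) := etrans (esym vf) vg; rewrite !mxE => -[].
rewrite card_ffun !card_ord in mE.
(* Infinite values are impossible: their positive multiples stay infinite, while the total is 1. *)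
case: (m (cube k 0)) mE => [r| |].
- rewrite -EFin_natmul => -[rE]; congr EFin.
  have k0 : (2 ^+ k : R) != 0 by rewrite expf_neq0.
  apply: (mulIf (expf_neq0 n k0)).
  by rewrite exprVn mulVf ?expf_neq0// -[RHS]rE -[RHS]mulr_natr !natrX.
- have /prednK <- : (0 < (2 ^ k) ^ n)%N by rewrite !expn_gt0.
  by rewrite enatmul_pinfty.
- have /prednK <- : (0 < (2 ^ k) ^ n)%N by rewrite !expn_gt0.
  by rewrite enatmul_ninfty.
Qed.

End CubeMeasure.

(** * Lebesgue measure *)

Section Lebesgue.
Context {R : realType}.

Lemma measurable_col_mx n : measurable_fun setT
  ((fun tv => col_mx tv.1%:M tv.2) : R * borel 'cV[R]_n -> borel 'cV[R]_n.+1).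
Proof.
apply: measurable_fun_cV => i; rewrite -[n.+1]/(1 + n)%N in i *.
case: (splitP i) => j ij.
  have -> : i = lshift n j by apply: val_inj.
  under eq_fun do rewrite col_mxEu (ord1 j) mxE eqxx mulr1n.
  exact: measurable_fst.
have -> : i = rshift 1 j by apply: val_inj.
under eq_fun do rewrite col_mxEd.
exact: measurableT_comp (measurable_coord j) measurable_snd.
Qed.

Lemma cube_col_mx n k (z : 'cV[int]_n.+1) (t : R) (v : 'cV[R]_n) :
  cube k z (col_mx t%:M v) <->
  Num.floor (2 ^+ k * t) = z 0 0 /\ cube k (\col_i z (lift ord0 i) 0) v.
Proof.
have E0 : (col_mx t%:M v : 'cV_n.+1) 0 0 = t.
  have := col_mxEu (t%:M : 'M[R]_1) v 0 0; rewrite [in RHS]mxE eqxx mulr1n => E.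
  rewrite -[RHS]E.
  by congr (col_mx _ _ _ _); exact: val_inj.
have E1 i : (col_mx t%:M v : 'cV_n.+1) (lift ord0 i) 0 = v i 0.
  have := col_mxEd (t%:M : 'M[R]_1) v i 0 => <-.
  by congr (col_mx _ _ _ _); exact: val_inj.
split=> [<-|[z0 vz]].
  by split; [rewrite mxE E0|apply/colP => i; rewrite [RHS]mxE [RHS]mxE E1 mxE].
apply/colP => i; case: (unliftP ord0 i) => [j|] ->; rewrite mxE ?E1 ?E0//.
by move/colP : vz => /(_ j); rewrite !mxE.
Qed.

Lemma floor_fiber k (z : int) : [set t : R | Num.floor (2 ^+ k * t) = z] =
  `[z%:~R / 2 ^+ k, (z + 1)%:~R / 2 ^+ k[%classic.
Proof.
have k0 : (0 : R) < 2 ^+ k by rewrite exprn_gt0.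
apply/seteqP; split=> t /=; rewrite in_itv/= ler_pdivrMr// ltr_pdivlMr// mulrC.
  by move=> <-; exact: floor_itv.
exact: floor_def.
Qed.

Lemma lebesgue_floor_fiber k (z : int) :
  lebesgue_measure [set t : R | Num.floor (2 ^+ k * t) = z] = (2 ^- k)%:E.
Proof.
have k0 : (0 : R) < 2 ^+ k by rewrite exprn_gt0.
rewrite floor_fiber lebesgue_measure_itv /= lte_fin ltr_pM2r ?invr_gt0//.
by rewrite ltr_int ltrDl ltr01 -EFinB -mulrBl intrD addrAC subrr add0r mul1r.
Qed.

(** An alias carrying the proof [sf], to which the sigma-finite structure can be attached. *)
Definition with_sigma_finite d (T : measurableType d) (m : {measure set T -> \bar R})
  (sf : sigma_finite setT m) : set T -> \bar R := m.

HB.instance Definition _ d (T : measurableType d) (m : {measure set T -> \bar R})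
  (sf : sigma_finite setT m) := Measure.on (with_sigma_finite sf).

HB.instance Definition _ d (T : measurableType d) (m : {measure set T -> \bar R})
  (sf : sigma_finite setT m) :=
  Measure_isSigmaFinite.Build d T R (with_sigma_finite sf) sf.

Lemma sigma_finite_cubes n (m : {measure set (borel 'cV[R]_n) -> \bar R}) :
  (forall z, m (cube 0 z) < +oo)%E ->
  exists m' : {sigma_finite_measure set (borel 'cV[R]_n) -> \bar R},
    m' = m :> (set (borel 'cV[R]_n) -> \bar R).
Proof.
move=> moo; have sf : sigma_finite setT m.
  exists (fun k => oapp (cube 0) set0 (@pickle_inv 'cV[int]_n k)).
    apply/seteqP; split=> // v _; exists (pickle (dyadic 0 v)) => //.
    by rewrite pickleK_inv.
  move=> k; case: pickle_inv => [z|] /=; last by rewrite measure0.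
  by split=> //; exact: measurable_cube.
by exists (with_sigma_finite sf).
Qed.

(** [lebesgue_cV] is only a set function. The measure it agrees with on Borel sets is built by
    induction on the dimension, as the image under [col_mx] of one-dimensional Lebesgue measure
    times the previous measure. *)
Lemma lebesgue_cV_measure n :
  exists m : {sigma_finite_measure set (borel 'cV[R]_n) -> \bar R},
    (forall B : set (borel 'cV[R]_n), measurable B ->
       lebesgue_cV (B : set 'cV[R]_n) = m B) /\
    forall k z, m (cube k z) = ((2 ^- k) ^+ n)%:E.
Proof.
elim: n => [|n [m [mE mc]]].
  have [|m mE] := @sigma_finite_cubes 0 (\d_(0%R : borel 'cV[R]_0)).
    by move=> z; rewrite /= /dirac indicE ltry.
  exists m; split=> [B _|k z]; first by rewrite mE.
  (* In dimension 0 the space is a single point, which lies in every cube. *)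
  rewrite mE /= /dirac indicE mem_set ?expr0//=.
  by apply/colP; case.
pose f : R * borel 'cV[R]_n -> borel 'cV[R]_n.+1 := fun tv => col_mx tv.1%:M tv.2.
have mf : measurable_fun setT f by exact: measurable_col_mx.
pose m1 := image_measure (lebesgue_measure \x m)%E mf.
have m1c k z : m1 (cube k z) = ((2 ^- k) ^+ n.+1)%:E.
  rewrite /= /pushforward.
  rewrite (_ : f @^-1` _ = [set t : R | Num.floor (2 ^+ k * t) = z 0 0] `*`
      cube k (\col_i z (lift ord0 i) 0)); last first.
    by apply/seteqP; split=> -[t v] /cube_col_mx.
  rewrite product_measure1E ?mc ?exprS.
  - by rewrite EFinM -(lebesgue_floor_fiber k (z 0 0)).
  - by rewrite floor_fiber; exact: measurable_itv.
  - exact: measurable_cube.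
have [|m' m'E] := @sigma_finite_cubes n.+1 m1.
  by move=> w; rewrite m1c ltry.
exists m'; split=> [B mB|k z]; last by rewrite m'E.
(* The product measure integrates the measures of sections, exactly as [lebesgue_cV] recurses; the
   sections are Borel, so [mE] applies. *)
rewrite m'E /= /pushforward /product_measure1; apply: eq_integral => t _ /=.
have mBt := measurable_xsection t (mf measurableT B mB).
rewrite setTI in mBt; rewrite -(mE _ mBt); congr lebesgue_cV.
by apply/seteqP; split=> v /=; rewrite /xsection /= inE.
Qed.

End Lebesgue.

(** * Bernoulli measure *)

Section Bernoulli.
Context {p : nat}.
Local Notation letter := 'I_p.+1.

Definition cylinder (w : seq letter) : set (leftseq p) :=
  [set x | mkseq x (size w) = w].

(** In left-infinite notation this is [... x_2 x_1 j]: index 0 holds the last letter, whose digit is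
    weighted by the first power of the inverse of [A]. *)
Definition shift_in (j : letter) (x : leftseq p) : leftseq p :=
  fun k => if k is k'.+1 then x k' else j.

Lemma measurable_cylinder w : @measurable _ (borel (leftseq p)) (cylinder w).
Proof.
have -> : cylinder w = \bigcap_(k in [set: 'I_(size w)])
    (fun x : leftseq p => x k) @^-1` [set nth ord0 w k].
  apply/seteqP; split=> [x xw k _|x xw] /=.
    by rewrite -(congr1 (nth ord0 ^~ k) xw) nth_mkseq.
  apply: (@eq_from_nth _ ord0); rewrite size_mkseq// => k kw.
  by rewrite nth_mkseq//; exact: (xw (Ordinal kw) Logic.I).
apply: (@fin_bigcap_measurable _ (borel (leftseq p))) => // k _.
apply: sub_sigma_algebra; apply: open_comp; last exact: discrete_open.
by move=> x _; exact: (@proj_continuous nat (fun=> discrete_topology letter)).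
Qed.

(** Otherwise each [k] has a point [y k] outside [U] sharing its first [k] letters with [x]; these
    points converge to [x], contradicting openness. *)
Lemma cylinder_base (U : set (leftseq p)) x : open U -> U x ->
  exists k, cylinder (mkseq x k) `<=` U.
Proof.
move=> oU Ux; apply: contrapT => /forallNP noU.
have /choice[y yP] k : exists y : leftseq p, cylinder (mkseq x k) y /\ ~ U y.
  by have := noU k => /existsNP[y /not_implyP]; exists y.
have yx : y @ \oo --> x.
  (* Convergence in the product topology is tested coordinatewise, and coordinate [N] of [y k]
     equals [x N] once [k > N]. *)
  apply/cvg_sup => N U' [V] [[W] oW <-] WxN WU.
  apply: (filterS WU); rewrite nbhs_simpl; exists N.+1 => // k /= Nk.
  have := (yP k).1; rewrite /cylinder /= size_mkseq => /(congr1 (nth ord0 ^~ N)).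
  by rewrite !nth_mkseq// => ->.
have /yx[N _ /(_ N (leqnn N))] : nbhs x U by exact: open_nbhs_nbhs.
exact: (yP N).2.
Qed.

Definition cylinders : set (set (leftseq p)) :=
  [set A | A = set0 \/ exists w, A = cylinder w].

Lemma borel_cylindersE : @measurable _ (borel (leftseq p)) = <<s cylinders >>.
Proof.
apply: (@borel_countable_base _ _ _ cylinder).
- move=> A [->|[w ->]]; last exact: measurable_cylinder.
  exact: (@measurable0 _ (borel (leftseq p))).
- by move=> w; right; exists w.
- move=> U x oU Ux; have [k kU] := cylinder_base oU Ux; exists (mkseq x k) => //.
  by rewrite /cylinder /= size_mkseq.
Qed.

(** Cylinders are nested or disjoint, according to whether the shorter word is a prefix of the
    longer one. *)
Lemma cylindersI : setI_closed cylinders.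
Proof.
move=> A B; case=> [->|[v ->]]; first by rewrite set0I; left.
case=> [->|[w ->]]; first by rewrite setI0; left.
wlog vw : v w / (size v <= size w)%N.
  move=> H; case/orP: (leq_total (size v) (size w)) => vw; first exact: H.
  by rewrite setIC; exact: H.
have takeE x : cylinder w x -> mkseq x (size v) = take (size v) w.
  by move=> <-; rewrite /mkseq -map_take take_iota (minn_idPl vw).
have [tw|/eqP tw] := eqVneq (take (size v) w) v.
  by right; exists w; apply/setIidPr => x /takeE; rewrite tw.
left; rewrite -subset0 => x [/= xv /takeE xw].
by apply: tw; rewrite -xw.
Qed.

Lemma shift_in_cylinder j a w :
  shift_in j @^-1` cylinder (a :: w) = if j == a then cylinder w else set0.
Proof.
have E x : cylinder (a :: w) (shift_in j x) <-> j :: mkseq x (size w) = a :: w.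
  by rewrite /cylinder /mkseq /= -[1%N]addn0 iotaDl -map_comp.
case: eqVneq => [ja|ja].
  subst a; apply/seteqP; split=> x; first by move=> /E[].
  by move=> xw; apply/E; rewrite xw.
by rewrite -subset0 => x /E[ja']; rewrite ja' eqxx in ja.
Qed.

Lemma measurable_shift_in j :
  measurable_fun setT (shift_in j : borel (leftseq p) -> borel (leftseq p)).
Proof.
apply: (measurability _ borel_cylindersE).
move=> _ [_ [->|[[|a w] ->]] <-]; rewrite setTI ?preimage_set0//.
  by rewrite (_ : cylinder [::] = setT) ?preimage_setT//; apply/seteqP; split.
rewrite shift_in_cylinder; case: ifP => // _; exact: measurable_cylinder.
Qed.

Context {R : realType} (nu : {measure set (borel (leftseq p)) -> \bar R}).
Hypothesis nuE : uniform_bernoulli nu.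
Local Open Scope ereal_scope.

Lemma bernoulli_setT : nu setT = 1.
Proof.
have := nuE [::]; rewrite expr0 invr1 => <-; congr (nu _).
by apply/seteqP; split.
Qed.

(** Self-similarity of [nu]: both sides are finite measures in [C], so comparing them on cylinders
    suffices. For a nonempty word only the branch adding its first letter survives. *)
Lemma bernoulli_shift (C : set (borel (leftseq p))) : measurable C ->
  nu C = (p.+1%:R^-1)%:E * \sum_(j < p.+1) nu (shift_in j @^-1` C).
Proof.
move=> mC; have p0 : (0 <= p.+1%:R^-1 :> R)%R by rewrite invr_ge0.
pose m2 := mscale (NngNum p0) (msum (fun k =>
  image_measure nu (measurable_shift_in (inord k))) p.+1).
have m2E D : m2 D = (p.+1%:R^-1)%:E * \sum_(j < p.+1) nu (shift_in j @^-1` D).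
  rewrite /m2 /mscale /= /msum; congr (_ * _).
  by apply: eq_bigr => j _; rewrite /pushforward inord_val.
rewrite -m2E.
apply: (@measure_unique _ R (borel (leftseq p)) cylinders (fun=> setT)) => //.
- exact: borel_cylindersE.
- exact: cylindersI.
- by move=> _; right; exists [::]; apply/seteqP; split.
- by rewrite bigcup_const.
- move=> _ [->|[[|a w] ->]]; first by rewrite !measure0.
    rewrite (_ : cylinder [::] = setT); last by apply/seteqP; split.
    apply: etrans (esym (m2E _)).
    under eq_bigr do rewrite preimage_setT bernoulli_setT.
    by rewrite bernoulli_setT sumEFin sumr_const card_ord -EFinM mulVf.
  apply: etrans (esym (m2E _)).
  under eq_bigr do rewrite shift_in_cylinder (fun_if nu) measure0.
  rewrite (bigD1 a)//= eqxx big1 => [|j /negPf->//].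
  by rewrite adde0 !nuE -EFinM exprS invfM.
- by move=> _; rewrite bernoulli_setT ltry.
Qed.

End Bernoulli.

(** One coordinate, scaled by [2 ^+ k], of the inclusion ending [tiling_cube_le]: [c] is the shift
    and [e] the thickness of the removed layer. *)
Lemma translate_itv (R : realFieldType) (z w b c e : R) :
  z - w - e < c -> c < z - w -> z <= b + c < z + 1 - e -> w <= b < w + 1.
Proof. lra. Qed.

Section LinearMaps.
Context {R : realType} {n : nat}.

Lemma measurable_addv (s : 'cV[R]_n) :
  measurable_fun setT ((fun v => v + s) : borel 'cV[R]_n -> borel 'cV[R]_n).
Proof.
apply: measurable_fun_cV => i; under eq_fun do rewrite mxE.
by apply: measurable_funD => //; exact: measurable_coord.
Qed.

Lemma measurable_mulmxv (M : 'M[R]_n) :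
  measurable_fun setT ((fun v => M *m v) : borel 'cV[R]_n -> borel 'cV[R]_n).
Proof.
apply: measurable_fun_cV => i; under eq_fun do rewrite mxE.
by apply: measurable_sum => j; apply: measurable_funM => //; exact: measurable_coord.
Qed.

End LinearMaps.

(** * The measure on Euclidean space *)

Section Tiling.
Context {R : realType} {n p : nat} {A : 'M[int]_n} {d : 'I_p.+1 -> 'cV[int]_n}.
Hypotheses (detA : `|\det A|%N = p.+1) (trD : coset_transversal A d).
Context {F : leftseq p -> 'cV[R]_n}.
Hypothesis mF : measurable_fun setT (F : borel (leftseq p) -> borel 'cV[R]_n).
Context {nu : {measure set (borel (leftseq p)) -> \bar R}}.
Hypothesis nuE : uniform_bernoulli nu.
Local Notation AR := (map_mx intr A : 'M[R]_n).
Hypothesis F_shift_in :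
  forall j x, AR *m F (shift_in j x) = int_cV (d j) + F x.

Lemma int_cVD (g h : 'cV[int]_n) : int_cV (g + h) = int_cV g + int_cV h :> 'cV[R]_n.
Proof. exact: map_mxD. Qed.

Lemma int_cVM (M : 'M[int]_n) (g : 'cV[int]_n) :
  int_cV (M *m g) = map_mx intr M *m int_cV g :> 'cV[R]_n.
Proof. exact: map_mxM. Qed.

Lemma unitmx_AR : AR \in unitmx.
Proof.
by rewrite unitmxE det_map_mx unitfE intr_eq0 -absz_eq0 detA.
Qed.

Lemma measurable_tile g :
  measurable_fun setT
    ((fun x => F x + int_cV g) : borel (leftseq p) -> borel 'cV[R]_n).
Proof. exact: (measurableT_comp (measurable_addv (int_cV g)) mF). Qed.

Local Open Scope ereal_scope.

(** The measure [mu] on Euclidean space; summing over codes of lattice vectors with [mseries]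
    supplies the measure structure. *)
Definition tiling_measure : {measure set (borel 'cV[R]_n) -> \bar R} :=
  mseries (fun k => oapp (fun g => image_measure nu (measurable_tile g)) mzero
    (@pickle_inv 'cV[int]_n k)) 0.

Lemma tiling_measureE B : tiling_measure B =
  \esum_(g in [set: 'cV[int]_n]) nu [set x | B (F x + int_cV g)%R].
Proof.
rewrite esum_pickle//; apply: eq_eseriesr => k _.
by case: pickle_inv.
Qed.

Lemma measurable_tile_preimage (B : set (borel 'cV[R]_n)) g : measurable B ->
  @measurable _ (borel (leftseq p)) [set x | B (F x + int_cV g)%R].
Proof. by move=> mB; have := measurable_tile g measurableT mB; rewrite setTI. Qed.

Lemma tiling_measure_intD (B : set (borel 'cV[R]_n)) h : measurable B ->
  tiling_measure [set y | B (y + int_cV h)%R] = tiling_measure B.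
Proof.
move=> mB; rewrite !tiling_measureE.
rewrite [RHS](reindex_esum setT _ (fun g => (g + h)%R)).
  by apply: eq_esum => g _ /=; under eq_set do rewrite -addrA -int_cVD.
split=> // [g k _ _ /addIr//|g _]; exists (g - h)%R => //; by rewrite subrK.
Qed.

(** The coset of a lattice vector determines its digit, and [A] is injective because its determinant
    is nonzero. *)
Lemma digit_bij : set_bij [set: 'cV[int]_n * 'I_p.+1] [set: 'cV[int]_n]
  (fun gj => A *m gj.1 + d gj.2)%R.
Proof.
split=> // [[g i] [h j] _ _ /= e|g _].
  have [k [_ ku]] := trD (A *m g + d i)%R.
  have ik : k = i by apply: ku; exists g; rewrite addrK.
  have jk : k = j by apply: ku; exists h; rewrite e addrK.
  subst i j; congr (_, _); apply: (mulA_inj detA); exact: addIr e.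
have [j [[h hj] _]] := trD g; exists (h, j) => //=.
by rewrite hj subrK.
Qed.

(** The sum for [B] is reindexed by [digit_bij]. For fixed [g], the sum over digits is the one in
    [bernoulli_shift], since [F_shift_in] turns [A (F (j x) + g)] into [F x + (A g + d j)]. *)
Lemma tiling_measure_mulA (B : set (borel 'cV[R]_n)) : measurable B ->
  tiling_measure [set y | B (AR *m y)%R] = (p.+1%:R^-1)%:E * tiling_measure B.
Proof.
move=> mB; rewrite !tiling_measureE.
rewrite [in RHS](reindex_esum _ _ _ _ digit_bij).
have -> : [set: 'cV[int]_n * 'I_p.+1] = setT `*`` (fun=> setT).
  by apply/seteqP; split.
rewrite -(esum_esum
  (a := fun g j => nu [set x | B (F x + int_cV (A *m g + d j))%R]))//.
under [in RHS]eq_esum do rewrite esum_fintype//.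
(* As series, the two sides can be compared term by term once [nneseriesZl] moves the factor
   inside. *)
rewrite esum_pickle// esum_pickle; last by move=> g; exact: sume_ge0.
rewrite -nneseriesZl; last first.
  by move=> k _; case: pickle_inv => //= g; exact: sume_ge0.
apply: eq_eseriesr => k _; case: pickle_inv => [g|] /=; last by rewrite mule0.
rewrite bernoulli_shift//; last first.
  have mAB := measurable_mulmxv AR measurableT mB; rewrite setTI in mAB.
  exact: (measurable_tile_preimage g mAB).
congr (_ * _); apply: eq_bigr => j _; congr (nu _).
apply/seteqP; split=> x /=; rewrite mulmxDr F_shift_in int_cVD int_cVM
  (addrC (AR *m _)%R) addrA (addrC (F x))//.
Qed.

Definition invariant_shift (s : 'cV[R]_n) := forall B : set (borel 'cV[R]_n),
  measurable B -> tiling_measure [set y | B (y + s)%R] = tiling_measure B.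

Lemma measurable_preimage_addv (B : set (borel 'cV[R]_n)) s : measurable B ->
  @measurable _ (borel 'cV[R]_n) [set y | B (y + s)%R].
Proof. by move=> mB; have := measurable_addv s measurableT mB; rewrite setTI. Qed.

Lemma invariant_shiftD s t :
  invariant_shift s -> invariant_shift t -> invariant_shift (s + t)%R.
Proof.
move=> si ti B mB; under eq_set do rewrite addrA.
rewrite (si [set y | B (y + t)%R]) ?ti//; exact: measurable_preimage_addv.
Qed.

(** With [B] written as the preimage of [C] under [A], both masses acquire the same factor and the
    shift becomes [s]. *)
Lemma invariant_shift_invA s :
  invariant_shift s -> invariant_shift (invmx AR *m s)%R.
Proof.
move=> si B mB; set C := [set z | B (invmx AR *m z)%R].
have mC : @measurable _ (borel 'cV[R]_n) C.
  by have := measurable_mulmxv (invmx AR) measurableT mB; rewrite setTI.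
have uA := unitmx_AR.
have -> : [set y | B (y + invmx AR *m s)%R] =
    [set y | [set z | C (z + s)%R] (AR *m y)%R].
  by apply/seteqP; split=> y; rewrite /C /= mulmxDr mulKmx.
have -> : B = [set y | C (AR *m y)%R].
  by apply/seteqP; split=> y; rewrite /C /= mulKmx.
rewrite !tiling_measure_mulA ?si//; exact: measurable_preimage_addv.
Qed.

(** Periods contain the lattice and are closed under addition and under the inverse of [A]. *)
Lemma invariant_shift_expansion (g : 'cV[int]_n) (x : leftseq p) N :
  invariant_shift (int_cV g + \sum_(k < N) invmx AR ^+ k.+1 *m int_cV (d (x k)))%R.
Proof.
elim: N => [|N IH].
  by rewrite big_ord0 addr0 => B mB; exact: tiling_measure_intD.
rewrite big_ord_recr /= addrA; apply: invariant_shiftD => //.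
have sM k s : invariant_shift s -> invariant_shift (invmx AR ^+ k *m s)%R.
  elim: k => [|k IHk] si; first by rewrite expr0 mul1mx.
  by rewrite exprS -mulmxA; apply/invariant_shift_invA/IHk.
by apply: sM => B mB; exact: tiling_measure_intD.
Qed.

Lemma dyadic0D (v : 'cV[R]_n) (g : 'cV[int]_n) :
  dyadic 0 (v + int_cV g)%R = (dyadic 0 v + g)%R.
Proof.
apply/colP => i; rewrite !mxE expr0 !mul1r floorDrz ?intrKfloor//.
Qed.

(** For each [x] exactly one lattice vector, [- dyadic 0 (F x)], moves [F x] into the unit cube, so
    the sets [D g] partition a probability space. *)
Lemma tiling_unit_cube : tiling_measure (cube 0 0%R) = 1.
Proof.
pose D (g : 'cV[int]_n) : set (borel (leftseq p)) :=
  [set x | cube 0 0%R (F x + int_cV g)%R].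
have mD g : measurable (D g).
  by apply: measurable_tile_preimage; exact: measurable_cube.
have tD : trivIset setT D.
  move=> g h _ _ [x []]; rewrite /D /cube /= !dyadic0D => eg eh.
  by apply: (addrI (dyadic 0 (F x))); rewrite eg eh.
rewrite tiling_measureE -(measure_countable_bigcup nu mD tD) -(bernoulli_setT nuE).
congr (nu _); apply/seteqP; split=> // x _.
by exists (- dyadic 0 (F x))%R => //; rewrite /D /cube /= dyadic0D subrr.
Qed.

Hypothesis dense : forall (t : 'cV[R]_n) (e : R), (0 < e)%R ->
  exists2 s, invariant_shift s & forall i, (t i 0%R - e < s i 0%R < t i 0%R)%R.

(** Half-open cubes shifted from slightly below still cover all of the cube
    except a thin layer at its open faces, so invariance under a dense set of
    shifts is enough. *)
Lemma tiling_cube_le k (z w : 'cV[int]_n) :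
  tiling_measure (cube k z) <= tiling_measure (cube k w).
Proof.
have k0 : (0 < 2 ^+ k :> R)%R by rewrite exprn_gt0.
(* [E N] is the cube with a layer of relative thickness [N.+1%:R^-1] removed at each open face. *)
pose E N : set 'cV[R]_n := [set v | forall i,
  ((z i 0)%:~R <= 2 ^+ k * v i 0 < (z i 0 + 1)%:~R - N.+1%:R^-1)%R].
have mE N : @measurable _ (borel 'cV[R]_n) (E N).
  have -> : E N = \bigcap_(i in [set: 'I_n])
      ((fun v : 'cV[R]_n => 2 ^+ k * v i 0) @^-1`
      `[(z i 0)%:~R, (z i 0 + 1)%:~R - N.+1%:R^-1[)%R.
    by apply/seteqP; split=> [v Ev i _|v Ev i]; [have := Ev i|have := Ev i Logic.I];
      rewrite /= in_itv.
  apply: (@fin_bigcap_measurable _ (borel 'cV[R]_n)) => // i _.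
  have mf : measurable_fun setT ((fun v => 2 ^+ k * v i 0)%R : borel 'cV[R]_n -> R).
    by apply: measurable_funM => //; exact: measurable_coord.
  by rewrite -[X in measurable X]setTI; exact: mf.
have ndE : nondecreasing_seq E.
  move=> M N MN; apply/subsetPset => v Ev i; have /andP[-> u] := Ev i.
  rewrite (lt_le_trans u)// lerB// lef_pV2 ?posrE ?ltr0n//.
  by rewrite ler_nat ltnS.
have cubeE : cube k z = \bigcup_N E N.
  apply/seteqP; split=> v; last first.
    move=> [N _ Ev]; apply/cubeP => i; have /andP[-> u] := Ev i.
    by rewrite (lt_le_trans u)// gerBl invr_ge0.
  move=> /cubeP zv.
  pose gap i := ((z i 0)%:~R + 1 - 2 ^+ k * v i 0%R)%R.
  have gap0 i : (0 < gap i)%R.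
    by have /andP[_] := zv i; rewrite intrD -subr_gt0.
  (* One [N] serves all coordinates: [N.+1] exceeds the inverse of every distance [gap i] to an open
     face. *)
  exists (\max_i Num.bound (gap i)^-1)%N => // i; have /andP[-> u] := zv i.
  rewrite ltrBrDl -ltrBrDr intrD -/(gap i) -[ltRHS]invrK ltf_pV2 ?posrE ?invr_gt0//.
  apply: (lt_le_trans (archi_boundP _)); first by rewrite invr_ge0 ltW.
  by rewrite ler_nat leqW// (leq_bigmax i).
(* By continuity from below it is enough to bound the mass of each [E N]. *)
have Ecvg : tiling_measure \o E @ \oo --> tiling_measure (cube k z).
  rewrite cubeE; apply: nondecreasing_cvg_mu => //.
  exact: bigcupT_measurable.
rewrite -(cvg_lim _ Ecvg)//; apply: lime_le.
  by apply/cvg_ex; exists (tiling_measure (cube k z)).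
apply: nearW => N /=.
(* [t] carries the cube [w] onto the cube [z]; a period [s] just below [t] pulls [E N] back into the
   cube [w]. *)
pose t : 'cV[R]_n := (\col_i (2 ^- k * ((z i 0)%:~R - (w i 0)%:~R)))%R.
have [|s si st] := @dense t (2 ^- k * N.+1%:R^-1)%R.
  by rewrite mulr_gt0 ?invr_gt0.
rewrite -(si _ (mE N)); apply: le_measure; rewrite ?inE.
- exact: measurable_preimage_addv.
- exact: measurable_cube.
- move=> y Ey; apply/cubeP => i; have := Ey i; have /andP[] := st i.
  rewrite !mxE -mulrBr ltr_pdivrMl// ltr_pdivlMl// mulrDr !intrD.
  exact: translate_itv.
Qed.

Lemma tiling_measure_cube k z :
  tiling_measure (cube k z) = ((2 ^- k) ^+ n)%:E.
Proof.
apply: measure_cube; first exact: tiling_unit_cube.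
by move=> l w; apply/eqP; rewrite eq_le !tiling_cube_le.
Qed.

End Tiling.

(** * Counting measure as a sum of indicators *)

Section Counting.
Local Open Scope ereal_scope.

Lemma counting_esum (R : realType) d (T : measurableType d) (S : set T) :
  counting S = \esum_(i in [set: T]) (\1_S i)%:E :> \bar R.
Proof.
have -> : \esum_(i in [set: T]) (\1_S i)%:E = \esum_(i in S) \d_ i S :> \bar R.
  rewrite [RHS]esum_mkcond; apply: eq_esum => i _.
  by rewrite /dirac indicE; case: (i \in S).
rewrite /counting; case: asboolP => fS; first by rewrite finite_card_dirac.
by rewrite infinite_card_dirac.
Qed.

End Counting.

Lemma continuous_pairr (S T : topologicalType) (t : T) :
  continuous (fun x : S => (x, t)).
Proof. by move=> x; apply: cvg_pair; [exact: cvg_id|exact: cvg_cst]. Qed.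

(** * The limit space *)

Section LimitSpace.
Context {R : realType} {n p : nat} {A : 'M[int]_n} {d : 'I_p.+1 -> 'cV[int]_n}.
Hypotheses (detA : `|\det A|%N = p.+1) (trD : coset_transversal A d).
Context {Phi : limit_space detA trD -> 'cV[R]_n}.
Hypothesis continuous_Phi : continuous Phi.
Hypothesis equivPhi : forall (x : leftseq p) (g h : 'cV[int]_n),
  Phi (limit_pi detA trD (x, g + h : 'cV[int]_n)) =
  Phi (limit_pi detA trD (x, g)) + int_cV h.
Local Notation AR := (map_mx intr A : 'M[R]_n).
Hypothesis PhiE : forall (x : leftseq p) (g : 'cV[int]_n),
  (fun N => int_cV g + \sum_(k < N) invmx AR ^+ k.+1 *m int_cV (d (x k)))
    @ \oo --> Phi (limit_pi detA trD (x, g)).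

Let F (x : leftseq p) := Phi (limit_pi detA trD (x, 0 : 'cV[int]_n)).

Lemma Phi_pi x (g : 'cV[int]_n) :
  Phi (limit_pi detA trD (x, g)) = F x + int_cV g.
Proof. by rewrite -equivPhi add0r. Qed.

Lemma measurable_digit_series :
  measurable_fun setT (F : borel (leftseq p) -> borel 'cV[R]_n).
Proof.
apply: continuous_borel => x.
apply: (@continuous_comp _ _ _ (fun x => limit_pi detA trD (x, 0 : 'cV[int]_n)) Phi).
  apply: (@continuous_comp _ _ _ (fun x : leftseq p => (x, 0 : lattice n))
    (limit_pi detA trD)).
    exact: continuous_pairr.
  exact: pi_continuous.
exact: continuous_Phi.
Qed.

Lemma cvg_coord (u : nat -> 'cV[R]_n) (v : 'cV[R]_n) i : u @ \oo --> v ->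
  (fun N => u N i 0) @ \oo --> v i 0.
Proof.
move=> uv; exact: (@cvg_comp _ _ _ u (fun w : 'cV[R]_n => w i 0) _ _ _ uv
  (@coord_continuous _ _ _ i 0 v)).
Qed.

Lemma cvg_mulmxv (M : 'M[R]_n) (u : nat -> 'cV[R]_n) (v : 'cV[R]_n) i :
  u @ \oo --> v ->
  (fun N => (M *m u N) i 0) @ \oo --> (M *m v) i 0.
Proof.
move=> uv; under eq_fun do rewrite mxE; rewrite mxE.
apply: cvg_big => //; first exact: add_continuous.
by move=> j _; apply: cvgM; [exact: cvg_cst|exact: cvg_coord].
Qed.

(** Multiplying the partial sums for [shift_in j x] by [A] frees the first digit [d j] and lowers
    the other powers by one, leaving the partial sums that converge to [Phi] at [(x, d j)]. *)
Lemma digit_series_shift_in j x :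
  AR *m F (shift_in j x) = int_cV (d j) + F x.
Proof.
have uA := unitmx_AR (R := R) detA.
apply/colP => i.
have l1 := @cvg_mulmxv AR _ _ i (@PhiE (shift_in j x) 0).
have := @PhiE x (d j); rewrite Phi_pi addrC => /(@cvg_coord _ _ i) l2.
(* The freed digit uses up one term, so [N.+1] terms on the left match [N] on the right. *)
apply: cvg_unique l2 => //; move: l1; rewrite -cvg_shiftS; apply: cvg_trans.
apply: near_eq_cvg; apply: nearW => N /=; congr (fun_of_matrix _ i 0).
rewrite /int_cV map_mx0 add0r big_ord_recl /= mulmxDr expr1 mulKVmx//.
congr (_ + _); rewrite mulmx_sumr; apply: eq_bigr => k _.
by rewrite /bump /= add0n add1n [in LHS]exprS -mulmxA mulKVmx.
Qed.

Lemma digit_expansion_dense (t : 'cV[R]_n) (e : R) :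
  (forall v, exists q, Phi q = v) -> 0 < e ->
  exists (x : leftseq p) (g : 'cV[int]_n) N, forall i,
    t i 0 - e < (int_cV g + \sum_(k < N)
      invmx AR ^+ k.+1 *m int_cV (d (x k)) : 'cV[R]_n) i 0 < t i 0.
Proof.
(* Aiming at [e / 2] below [t] with error less than [e / 2] yields both strict bounds. *)
move=> surj e0; have [q qt] := surj (t - const_mx (e / 2)).
have [[x g] xg] : exists u, limit_pi detA trD u = q.
  by exists (repr q); exact: reprK.
have e2 : 0 < e / 2 by rewrite divr_gt0.
have := @PhiE x g; rewrite xg qt => /cvg_ballP/(_ _ e2)[N _ /(_ N (leqnn N))[_ dN]].
exists x, g, N => i; have := dN i 0; rewrite /ball /=.
move: (int_cV g + _) => s; rewrite !mxE ltr_norml => /andP[].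
by move: (t i 0) (s i 0) => a b; lra.
Qed.

(** The product measure integrates over [x] the number of [g] with [F x + g] in [B]. Written as a
    series of indicators, this count is integrated term by term. *)
Lemma limit_measure_tiling (nu : {measure set (borel (leftseq p)) -> \bar R})
    (B : set (borel 'cV[R]_n)) : measurable B ->
  pushforward (limit_measure detA trD nu)
    (Phi : borel (limit_space detA trD) -> borel 'cV[R]_n) B =
  tiling_measure measurable_digit_series (nu := nu) B.
Proof.
move=> mB; rewrite /pushforward /limit_measure /pushforward /product_measure1.
pose f (g : 'cV[int]_n) (x : borel (leftseq p)) : \bar R :=
  (\1_[set x | B (F x + int_cV g)] x)%:E.
have f0 g x : (0 <= f g x)%E by rewrite /f lee_fin.
have mf g : measurable_fun setT (f g).
  apply/measurable_EFinP; apply: measurable_indic.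
  exact: (measurable_tile_preimage measurable_digit_series g mB).
pose h k x := oapp (f ^~ x) 0%E (@pickle_inv 'cV[int]_n k).
transitivity (\int[nu]_x \sum_(k <oo) h k x)%E.
  apply: eq_integral => x _ /=; rewrite counting_esum.
  rewrite -(esum_pickle (a := fun g => f g x))//.
  apply: eq_esum => g _; rewrite /f !indicE; congr ((nat_of_bool _)%:R%:E).
  by apply/idP/idP; rewrite !inE /xsection /= inE /= Phi_pi.
rewrite integral_nneseries//; last 2 first.
- by move=> k; rewrite /h; case: pickle_inv => //= g; exact: mf.
- by move=> k x _; rewrite /h; case: pickle_inv => /=.
apply: eq_eseriesr => k _; rewrite /h; case: pickle_inv => [g|] /=.
  rewrite integral_indic ?setIT//.
  exact: (measurable_tile_preimage measurable_digit_series g mB).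
by rewrite integral0.
Qed.

End LimitSpace.

Theorem proposition25 (R : realType) (n p : nat) (A : 'M[int]_n)
  (eigA : forall z : R[i],
     eigenvalue (map_mx intr A : 'M[R[i]]_n) z -> 1 < `|z|)
  (detA : `|\det A|%N = p.+1)
  (d : 'I_p.+1 -> 'cV[int]_n) (trD : coset_transversal A d)
  (Phi : limit_space detA trD -> 'cV[R]_n)
  (homeoPhi : homeomorphism Phi)
  (equivPhi : forall (x : leftseq p) (g h : 'cV[int]_n),
     Phi (limit_pi detA trD (x, g + h : 'cV[int]_n))
     = Phi (limit_pi detA trD (x, g)) + int_cV h)
  (PhiE : forall (x : leftseq p) (g : 'cV[int]_n),
     (fun N => int_cV g + \sum_(k < N)
        invmx (map_mx intr A : 'M[R]_n) ^+ k.+1 *m int_cV (d (x k)))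
       @ \oo --> Phi (limit_pi detA trD (x, g)))
  (nu : {measure set (borel (leftseq p)) -> \bar R})
  (nuE : uniform_bernoulli nu)
  (B : set (borel 'cV[R]_n)) (mB : measurable B) :
  pushforward (limit_measure detA trD nu)
    (Phi : borel (limit_space detA trD) -> borel 'cV[R]_n) B = lebesgue_cV B.
Proof.
have [cPhi [Psi [_ _ PsiK]]] := homeoPhi.
have dense (t : 'cV[R]_n) (e : R) : 0 < e -> exists2 s,
    invariant_shift (measurable_digit_series cPhi) (nu := nu) s &
    forall i, t i 0 - e < s i 0 < t i 0.
  move=> e0; have [|x [g [N tN]]] :=
      @digit_expansion_dense R n p A d detA trD Phi PhiE t e _ e0.
    by move=> v; exists (Psi v).
  exists (int_cV g + \sum_(k < N)
    invmx (map_mx intr A : 'M[R]_n) ^+ k.+1 *m int_cV (d (x k))) => //.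
  exact: (invariant_shift_expansion detA trD _ nuE
    (digit_series_shift_in equivPhi PhiE)).
have tE := tiling_measure_cube nuE dense.
rewrite (limit_measure_tiling cPhi equivPhi)//.
(* Replacing [lebesgue_cV] by the measure [m] makes uniqueness on cubes applicable. *)
have [m [mE mc]] := @lebesgue_cV_measure R n.
rewrite mE//; apply: measure_cubes_unique => // [z|k z].
  by rewrite tE ltry.
by rewrite tE; exact/esym/mc.
Qed.
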